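(* Let $\Theta$ be a finite set, $\pi\in\Delta(\Theta)$ a full-support prior, $A\subset\mathbb{R}^\Theta$ a finite nonempty set of actions, and let $\kappa>0$ satisfy $$\kappa>\max_{\theta\in\Theta,a\in A}a(\theta)-\min_{\theta\in\Theta,a\in A}a(\theta).$$ Let the cost be $\chi^2$-information with parameter $\kappa$. Then a stochastic choice rule $P=(P_\theta)_{\theta\in\Theta}\in\Delta(A)^\Theta$ is optimal if and only if it satisfies $$P_\theta(a)=\alpha(a)+\alpha(a)\left(\frac{a(\theta)-\sum_{b\in A}\alpha(b)b(\theta)}{\kappa}\right)\qquad\forall a\in A,\ \theta\in\Theta$$ for some probability measure $\alpha\in\Delta(A)$ that solves $$\max_{\alpha\in\Delta(A)}\ \sum_{a\in A}\alpha(a)m_a+\frac1{4\kappa}\sum_{a,b\in A}\alpha(a)\alpha(b)D_{ab},$$ where $m_a=\sum_{\theta\in\Theta}\pi(\theta)a(\theta)$ and $D_{ab}=\sum_{\theta\in\Theta}\pi(\theta)(a(\theta)-b(\theta))^2$.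
   Context: $a(\theta)$ is the utility of action $a\in A\subset\mathbb{R}^\Theta$ in state $\theta$. $\chi^2$-information with parameter $\kappa>0$ is the cost $$I(P,\pi)=\min_{\alpha\in\Delta(A)}\sum_{\theta\in\Theta}\pi(\theta)\sum_{a\in A}\alpha(a)\phi\Big(\frac{P_\theta(a)}{\alpha(a)}\Big),\qquad \phi(t)=\frac{\kappa}{2}(t-1)^2,\ t\ge0,$$ with the convention $0\cdot\phi(x/0)=\lim_{t\to+\infty}\phi(1+tx)/t$ (i.e. $0$ if $x=0$ and $+\infty$ if $x>0$). A stochastic choice rule $P\in\Delta(A)^\Theta$ is optimal if it maximizes $\sum_\theta\pi(\theta)\sum_{a}P_\theta(a)a(\theta)-I(P,\pi)$ over $\Delta(A)^\Theta$. *)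

(* Defs.v *)
From HB Require Import structures.
From mathcomp Require Import all_boot all_order all_algebra.
From mathcomp Require Import finmap.
From mathcomp Require Import all_classical all_reals all_analysis.
From mathcomp Require Import ring lra.

Set Implicit Arguments.
Unset Strict Implicit.
Unset Printing Implicit Defensive.

Import Order.TTheory GRing.Theory Num.Theory.
Import numFieldNormedType.Exports.

Local Open Scope classical_set_scope.
Local Open Scope ring_scope.

Definition maximizer (d : Order.disp_t) (V : porderType d) (T : Type)
    (S : set T) (f : T -> V) : set T :=
  [set x | S x /\ forall y, S y -> (f y <= f x)%O].

Definition simplex (R : realType) (T : finType) : set {ffun T -> R} :=
  [set p | (forall x, 0 <= p x) /\ \sum_x p x = 1].

Definition choice_rules (R : realType) (Theta T : finType) :
    set (Theta -> {ffun T -> R}) :=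
  [set P | forall theta, simplex (P theta)].

(* [w * phi (x / w)], with the convention
   [0 * phi (x / 0) = lim_{t -> +oo} phi (1 + t x) / t], possibly [+oo]. *)
Definition perspective (R : realType) (phi : R -> R) (w x : R) : \bar R :=
  if w == 0 then lim ((phi (1 + t * x) / t)%:E @[t --> +oo])
  else (w * phi (x / w))%:E.

Definition divergence_cost (R : realType) (Theta T : finType) (phi : R -> R)
    (prior : {ffun Theta -> R}) (P : Theta -> {ffun T -> R})
    (alpha : {ffun T -> R}) : \bar R :=
  (\sum_theta (prior theta)%:E *
     \sum_a perspective phi (alpha a) (P theta a))%E.

(* The infimum is attained in the chi^2 case: see [chi2_information_attained]. *)
Definition information (R : realType) (Theta T : finType) (phi : R -> R)
    (P : Theta -> {ffun T -> R}) (prior : {ffun Theta -> R}) : \bar R :=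
  ereal_inf (divergence_cost phi prior P @` @simplex R T).

Definition chi2_phi (R : realType) (kappa t : R) : R :=
  kappa / 2 * (t - 1) ^+ 2.

Definition chi2_information (R : realType) (Theta T : finType) (kappa : R)
    (P : Theta -> {ffun T -> R}) (prior : {ffun Theta -> R}) : \bar R :=
  information (chi2_phi kappa) P prior.

Section DecisionProblem.
Variables (R : realType) (Theta : finType).
Variables (prior : {ffun Theta -> R}) (A : {fset {ffun Theta -> R}}).
Implicit Types (a b : A) (P : Theta -> {ffun A -> R}) (alpha : {ffun A -> R}).

Definition utility a (theta : Theta) : R := val a theta.

(* The maximum and minimum are taken in [\bar R] so that the neutral elements
   [-oo] and [+oo] do not interfere with the values of the utilities. *)
Definition max_utility : \bar R :=
  \big[maxe/-oo%E]_theta \big[maxe/-oo%E]_a (utility a theta)%:E.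

Definition min_utility : \bar R :=
  \big[mine/+oo%E]_theta \big[mine/+oo%E]_a (utility a theta)%:E.

Definition expected_utility P : R :=
  \sum_theta prior theta * \sum_a P theta a * utility a theta.

Definition payoff (kappa : R) P : \bar R :=
  ((expected_utility P)%:E - chi2_information kappa P prior)%E.

Definition optimal (kappa : R) : set (Theta -> {ffun A -> R}) :=
  maximizer (@choice_rules R Theta A) (payoff kappa).

Definition mean_utility a : R := \sum_theta prior theta * utility a theta.

Definition sq_dist a b : R :=
  \sum_theta prior theta * (utility a theta - utility b theta) ^+ 2.

Definition quadratic_objective (kappa : R) alpha : R :=
  \sum_a alpha a * mean_utility a
  + (4 * kappa)^-1 * \sum_a \sum_b alpha a * alpha b * sq_dist a b.

End DecisionProblem.

Lemma chi2_perspective0 (R : realType) (kappa x : R) : 0 < kappa -> 0 <= x ->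
  perspective (chi2_phi kappa) 0 x = if x == 0 then 0%E else +oo%E.
Proof.
move=> k0 x0; rewrite /perspective eqxx.
have [->|xn0] := eqVneq x 0.
  rewrite (_ : (fun t => _) = cst 0%E); first exact: lim_cst.
  by apply/funext => t; rewrite /chi2_phi mulr0 addr0 subrr expr0n/= mulr0 mul0r.
apply/cvg_lim => //; apply/cvgeyPge => M.
have c0 : 0 < kappa / 2 * x ^+ 2.
  by rewrite mulr_gt0 ?divr_gt0// exprn_gt0// lt0r xn0.
near=> t.
have t0 : 0 < t by near: t; apply: nbhs_pinfty_gt; rewrite num_real.
rewrite lee_fin /chi2_phi.
have -> : kappa / 2 * (1 + t * x - 1) ^+ 2 / t = kappa / 2 * x ^+ 2 * t.
  by field; rewrite gt_eqF.
rewrite mulrC -ler_pdivrMr//.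
Unshelve. all: by end_near. Qed.

Lemma chi2_perspective_ge (R : realType) (kappa t w x : R) :
  0 < kappa -> 0 <= w -> 0 <= x ->
  ((kappa / 2 * (2 * (t - 1) * x + (1 - t ^+ 2) * w))%:E
     <= perspective (chi2_phi kappa) w x)%E.
Proof.
move=> k0 w0 x0; have [->|wn0] := eqVneq w 0.
  rewrite chi2_perspective0//; case: eqVneq => [->|_]; last by rewrite leey.
  by rewrite !mulr0 addr0 mulr0.
rewrite /perspective (negbTE wn0) lee_fin /chi2_phi -subr_ge0.
have -> : w * (kappa / 2 * (x / w - 1) ^+ 2) -
    kappa / 2 * (2 * (t - 1) * x + (1 - t ^+ 2) * w) =
    kappa / 2 * (w * (x / w - t) ^+ 2) by field.
by rewrite mulr_ge0 ?divr_ge0 ?(ltW k0)// mulr_ge0// sqr_ge0.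
Qed.

Lemma chi2_perspective_eq (R : realType) (kappa t w : R) : 0 < kappa ->
  perspective (chi2_phi kappa) w (t * w) =
  (kappa / 2 * (2 * (t - 1) * (t * w) + (1 - t ^+ 2) * w))%:E.
Proof.
move=> k0; have [->|wn0] := eqVneq w 0.
  by rewrite mulr0 chi2_perspective0// eqxx !mulr0 addr0 mulr0.
by rewrite /perspective (negbTE wn0) /chi2_phi; congr EFin; field.
Qed.

Lemma chi2_information_attained (R : realType) (Theta T : finType) (kappa : R)
    (prior : {ffun Theta -> R}) (P : Theta -> {ffun T -> R}) :
  0 < kappa -> simplex prior -> (forall theta, 0 < prior theta) ->
  choice_rules P ->
  exists2 alpha, simplex alpha &
    chi2_information kappa P prior =
      divergence_cost (chi2_phi kappa) prior P alpha /\
    (forall beta, simplex beta ->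
      (divergence_cost (chi2_phi kappa) prior P alpha <=
       divergence_cost (chi2_phi kappa) prior P beta)%E).
Proof.
move=> k0 [prior_ge0 prior1] prior_gt0 HP.
have P0 theta a : 0 <= P theta a by case: (HP theta).
pose c a := \sum_theta prior theta * P theta a ^+ 2.
have c0 a : 0 <= c a by apply: sumr_ge0 => i _; rewrite mulr_ge0// sqr_ge0.
pose s a := Num.sqrt (c a); pose S := \sum_a s a.
have s0 a : 0 <= s a by exact: sqrtr_ge0.
have sP a : s a = 0 -> forall theta, P theta a = 0.
  move=> /eqP; rewrite sqrtr_eq0 => ca0 theta.
  have /eqP : c a = 0 by apply/eqP; rewrite eq_le ca0 c0.
  rewrite psumr_eq0; last by move=> i _; rewrite mulr_ge0// sqr_ge0.
  move=> /allP/(_ theta (mem_index_enum _))/=.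
  by rewrite mulf_eq0 gt_eqF//= sqrf_eq0 => /eqP.
have S0 : 0 < S.
  rewrite lt_def sumr_ge0// andbT; apply/eqP => /eqP.
  rewrite psumr_eq0// => /allP h.
  have [theta _|] := pickP (fun theta : Theta => true).
    have [_] := HP theta; rewrite big1; first by move/esym/eqP; rewrite oner_eq0.
    by move=> a _; apply: sP; apply/eqP; exact: h (mem_index_enum _).
  move=> h0; move/eqP: prior1; rewrite big_pred0 ?(eq_sym 0) ?oner_eq0//.
pose alpha : {ffun T -> R} := [ffun a => s a / S].
have alpha_s : simplex alpha.
  split=> [a|]; first by rewrite ffunE divr_ge0// ltW.
  under eq_bigr do rewrite ffunE.
  by rewrite -mulr_suml divff// gt_eqF.
pose t theta a := P theta a / alpha a.
have tP theta a : t theta a * alpha a = P theta a.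
  rewrite /t; have [a0|a0] := eqVneq (alpha a) 0; last by rewrite divfK.
  rewrite a0 mulr0 sP//; apply/eqP; move/eqP: a0.
  by rewrite ffunE mulf_eq0 invr_eq0 (gt_eqF S0) orbF.
pose k a := \sum_theta prior theta * t theta a ^+ 2.
have kE a : k a = if alpha a == 0 then 0 else S ^+ 2.
  have kc : k a = c a / alpha a ^+ 2.
    rewrite /k /c mulr_suml; apply: eq_bigr => i _.
    by rewrite /t expr_div_n mulrA.
  rewrite kc; case: eqVneq => [->|]; first by rewrite expr0n/= invr0 mulr0.
  rewrite ffunE mulf_eq0 invr_eq0 (gt_eqF S0) orbF => sn0.
  rewrite -(sqr_sqrtr (c0 a)) -/(s a); field.
  by rewrite sn0 gt_eqF.
pose L (beta : {ffun T -> R}) : R := \sum_theta prior theta * \sum_a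
  (kappa / 2 * (2 * (t theta a - 1) * P theta a + (1 - t theta a ^+ 2) * beta a)).
have LE beta : L beta = \sum_theta prior theta *
    \sum_a (kappa / 2 * (2 * (t theta a - 1) * P theta a)) +
    kappa / 2 * \sum_a (1 - k a) * beta a.
  have -> : \sum_a (1 - k a) * beta a =
      \sum_theta prior theta * \sum_a (1 - t theta a ^+ 2) * beta a.
    under [RHS]eq_bigr do rewrite mulr_sumr.
    rewrite exchange_big/=; apply: eq_bigr => a _.
    rewrite -{1}prior1 /k -sumrB mulr_suml; apply: eq_bigr => i _.
    by ring.
  rewrite mulr_sumr -big_split/=; apply: eq_bigr => i _.
  rewrite mulrCA -mulrDr; congr (_ * _); rewrite [X in _ = _ + X]mulr_sumr -big_split/=.
  by apply: eq_bigr => a _; rewrite mulrDr.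
have LE_alpha : divergence_cost (chi2_phi kappa) prior P alpha = (L alpha)%:E.
  rewrite /divergence_cost /L -sumEFin; apply: eq_bigr => i _.
  rewrite EFinM -sumEFin; congr (_ * _)%E; apply: eq_bigr => a _.
  by rewrite -[in LHS](tP i a) chi2_perspective_eq// tP.
have L_le beta : simplex beta ->
    ((L beta)%:E <= divergence_cost (chi2_phi kappa) prior P beta)%E.
  move=> [b0 _]; rewrite /divergence_cost /L -sumEFin; apply: lee_sum => i _.
  rewrite EFinM -sumEFin lee_pmul2l// ?lte_fin//.
  by apply: lee_sum => a _; exact: chi2_perspective_ge.
have Lmin beta : simplex beta -> L alpha <= L beta.
  move=> [b0 b1]; rewrite !LE lerD2l ler_pM2l ?divr_gt0//.
  have -> : \sum_a (1 - k a) * alpha a = 1 - S ^+ 2.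
    rewrite -[RHS]mulr1 -[X in _ = _ * X](proj2 alpha_s) mulr_sumr; apply: eq_bigr => a _.
    by rewrite kE; case: eqVneq => // ->; rewrite !mulr0.
  rewrite -[leLHS]mulr1 -[X in _ * X <= _]b1 mulr_sumr; apply: ler_sum => a _.
  rewrite ler_wpM2r// lerD2l lerN2 kE; case: ifP => // _.
  exact: sqr_ge0.
have amin beta : simplex beta ->
    (divergence_cost (chi2_phi kappa) prior P alpha <=
     divergence_cost (chi2_phi kappa) prior P beta)%E.
  by move=> sb; rewrite LE_alpha (le_trans _ (L_le _ sb))// lee_fin Lmin.
exists alpha => //; split=> //; apply/eqP; rewrite eq_le; apply/andP; split.
  by apply: ereal_inf_lbound; exists alpha.
by apply: le_ereal_inf_tmp => _ [beta sb <-]; exact: amin.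
Qed.

(* Main.v *)
(** For a choice rule [P] and an unconditional distribution [alpha], let
    [F P alpha] be the expected utility of [P] minus the divergence cost of
    [P] relative to [alpha]; the payoff of [P] is the maximum of [F P] over
    [alpha].  For fixed [alpha], [F] is concave in [P] and its maximizer on the
    affine hull of the simplex is
    [alpha (1 + (a - E_alpha b) / kappa)], which is nonnegative thanks to the
    bound on the range of the utilities.  The maximal value is the quadratic
    objective of [alpha], because [\sum_(a, b) alpha a alpha b (a - b)^2] is
    twice the variance.  Both implications follow by maximizing [F] jointly. *)
Require Import Defs.
From mathcomp Require Import all_boot all_order all_algebra.
From mathcomp Require Import finmap.
From mathcomp Require Import all_classical all_reals all_analysis.
From mathcomp Require Import ring.

Import Order.TTheory GRing.Theory Num.Theory.
Local Open Scope fset_scope.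
Local Open Scope ring_scope.

(** The bounds [f j] are finite, so those with [j != i] cancel in [\bar R] and leave no slack in the
    term [i]. *)
Lemma lee_sum_EFin_eq {R : realType} {I : finType} (f : I -> R)
    (g : I -> \bar R) :
  (forall i, ((f i)%:E <= g i)%E) -> (\sum_i g i <= (\sum_i f i)%:E)%E ->
  forall i, g i = (f i)%:E.
Proof.
move=> fg le_gf i; apply/eqP; rewrite eq_le fg andbT.
rewrite -(@leeD2rE _ (\sum_(j | j != i) f j)%:E)// -EFinD.
have <- : \sum_j f j = f i + \sum_(j | j != i) f j by rewrite (bigD1 i).
apply: le_trans le_gf; rewrite [leRHS](bigD1 i)//= leeD2l// -sumEFin.
exact: lee_sum.
Qed.

(* The coefficients are those of the tangent plane of
   [w * chi2_phi kappa (x / w)] along the ray [x = t * w]. *)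
Definition tangent_cost {R : realType} {Theta T : finType} (kappa : R)
    (prior : {ffun Theta -> R}) (t : Theta -> T -> R)
    (P : Theta -> {ffun T -> R}) (alpha : {ffun T -> R}) : R :=
  \sum_theta prior theta * \sum_a kappa / 2 *
    (2 * (t theta a - 1) * P theta a + (1 - t theta a ^+ 2) * alpha a).

(** * Tangent bound on the divergence cost and its equality case *)

Section TangentCost.
Context {R : realType} {Theta T : finType}.
Variables (kappa : R) (prior : {ffun Theta -> R}) (t : Theta -> T -> R).
Variables (P : Theta -> {ffun T -> R}) (alpha : {ffun T -> R}).
Hypothesis kappa_gt0 : 0 < kappa.
Hypothesis prior_gt0 : forall theta, 0 < prior theta.

Let tangent theta a : R := kappa / 2 *
  (2 * (t theta a - 1) * P theta a + (1 - t theta a ^+ 2) * alpha a).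

Lemma divergence_cost_ray :
    (forall theta a, P theta a = t theta a * alpha a) ->
  divergence_cost (chi2_phi kappa) prior P alpha =
    (tangent_cost kappa prior t P alpha)%:E.
Proof.
move=> Pt; rewrite /divergence_cost /tangent_cost -sumEFin.
apply: eq_bigr => theta _; rewrite EFinM -sumEFin; congr (_ * _)%E.
by apply: eq_bigr => a _; rewrite !Pt chi2_perspective_eq.
Qed.

Hypothesis P_ge0 : forall theta a, 0 <= P theta a.
Hypothesis alpha_ge0 : forall a, 0 <= alpha a.

(** For [alpha a != 0] the gap is [kappa / 2 * alpha a * (P theta a / alpha a - t theta a) ^+ 2].
    For [alpha a = 0] the tangent value is finite, which excludes [+oo] and forces
    [P theta a = 0]. *)
Lemma perspective_tangent_eq (theta : Theta) (a : T) :
  perspective (chi2_phi kappa) (alpha a) (P theta a) = (tangent theta a)%:E ->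
  P theta a = t theta a * alpha a.
Proof.
rewrite /tangent; have [->|alpha_neq0] := eqVneq (alpha a) 0.
  by rewrite chi2_perspective0// !mulr0; case: eqVneq.
rewrite /perspective (negbTE alpha_neq0) /chi2_phi => -[/eqP].
rewrite -subr_eq0 (_ : _ - _ = kappa / 2 * alpha a *
    (P theta a / alpha a - t theta a) ^+ 2); last by field.
rewrite !mulf_eq0 invr_eq0 (gt_eqF kappa_gt0) (negbTE alpha_neq0).
by rewrite pnatr_eq0/= orbb subr_eq0 => /eqP <-; rewrite divfK.
Qed.

Let state_cost theta : \bar R :=
  (\sum_a perspective (chi2_phi kappa) (alpha a) (P theta a))%E.

Let tangent_le_state_cost theta :
  ((\sum_a tangent theta a)%:E <= state_cost theta)%E.
Proof.
by rewrite -sumEFin; apply: lee_sum => a _; exact: chi2_perspective_ge.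
Qed.

Let prior_tangent_le theta :
  ((prior theta * \sum_a tangent theta a)%:E
     <= (prior theta)%:E * state_cost theta)%E.
Proof. by rewrite EFinM lee_pmul2l// lte_fin. Qed.

Lemma tangent_cost_le :
  ((tangent_cost kappa prior t P alpha)%:E
     <= divergence_cost (chi2_phi kappa) prior P alpha)%E.
Proof.
rewrite /tangent_cost -sumEFin; apply: lee_sum => theta _.
exact: prior_tangent_le.
Qed.

(** Tightness descends from the total to each state, where the positive prior cancels, and then to
    each action. *)
Lemma divergence_cost_le_tangent :
    (divergence_cost (chi2_phi kappa) prior P alpha
       <= (tangent_cost kappa prior t P alpha)%:E)%E ->
  forall theta a, P theta a = t theta a * alpha a.
Proof.
move=> le_cost theta a; apply: perspective_tangent_eq.
have := lee_sum_EFin_eq _ _ prior_tangent_le le_cost theta.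
move=> /eqP; rewrite EFinM eq_le => /andP[+ _].
rewrite lee_pmul2l ?lte_fin// => le_state.
apply: (lee_sum_EFin_eq (tangent theta)) le_state a => b.
exact: chi2_perspective_ge.
Qed.

End TangentCost.

(** * The choice rule induced by an unconditional distribution *)

Section DecisionProblem.
Context {R : realType} {Theta : finType}.
Variables (prior : {ffun Theta -> R}) (A : {fset {ffun Theta -> R}}).
Variable kappa : R.
Implicit Types (a b : A) (alpha : {ffun A -> R}) (P : Theta -> {ffun A -> R}).

Definition average_utility alpha theta : R :=
  \sum_(b : A) alpha b * utility b theta.

(** The slope [t] for which [utility a theta - kappa * (t - 1)] is the same for all [a]: the
    first-order condition in [P theta] at fixed total mass. *)
Definition likelihood_ratio alpha theta a : R :=
  1 + (utility a theta - average_utility alpha theta) / kappa.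

Definition tilted_rule alpha : Theta -> {ffun A -> R} :=
  fun theta => [ffun a => likelihood_ratio alpha theta a * alpha a].

Lemma utility_range a b theta :
  (max_utility A - min_utility A < kappa%:E)%E ->
  utility b theta - utility a theta < kappa.
Proof.
rewrite -lte_fin EFinB; apply: le_lt_trans; apply: leeB.
  apply: le_trans (le_bigmax _ _ theta).
  exact: (le_bigmax _ (fun b => (utility b theta)%:E)).
by apply: (bigmin_inf theta) => //; apply: (bigmin_inf a).
Qed.

Lemma sum_utility_gap alpha theta : simplex alpha ->
  \sum_a alpha a * (utility a theta - average_utility alpha theta) = 0.
Proof.
move=> [_ alpha1]; under eq_bigr do rewrite mulrBr.
by rewrite sumrB -mulr_suml alpha1 mul1r subrr.
Qed.

(** The average utility is at most [utility a theta + kappa], which gives nonnegativity; the mass is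
    1 because the utility gaps average to 0. *)
Lemma tilted_rule_choice alpha :
    0 < kappa -> (max_utility A - min_utility A < kappa%:E)%E ->
  simplex alpha -> choice_rules (tilted_rule alpha).
Proof.
move=> kappa_gt0 range_lt alpha_simplex theta.
have [alpha_ge0 alpha1] := alpha_simplex; split=> [a|].
  rewrite ffunE mulr_ge0// /likelihood_ratio -[1](@divff _ kappa) ?gt_eqF//.
  rewrite -mulrDl divr_ge0 ?(ltW kappa_gt0)// addrA subr_ge0 /average_utility.
  rewrite -[leRHS]mul1r -alpha1 mulr_suml; apply: ler_sum => b _.
  by rewrite ler_wpM2l// -lerBlDr ltW// utility_range.
under eq_bigr do rewrite ffunE mulrC mulrDr mulr1 mulrA.
by rewrite big_split/= alpha1 -mulr_suml sum_utility_gap// mul0r addr0.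
Qed.

Lemma sum_sq_diff alpha (x : A -> R) : simplex alpha ->
  \sum_a \sum_b alpha a * alpha b * (x a - x b) ^+ 2 =
  2 * \sum_a alpha a * (x a - \sum_b alpha b * x b) ^+ 2.
Proof.
move=> [_ alpha1]; set m := \sum_b alpha b * x b.
have sum0 : \sum_b alpha b * (x b - m) = 0.
  under eq_bigr do rewrite mulrBr.
  by rewrite sumrB -mulr_suml alpha1 mul1r subrr.
set V := \sum_a alpha a * (x a - m) ^+ 2.
transitivity (\sum_a (alpha a * (x a - m) ^+ 2 + alpha a * V)); last first.
  by rewrite big_split/= -mulr_suml alpha1 mul1r mulr2n mulrDl mul1r.
apply: eq_bigr => a _.
(* The difference [x a - x b] is expanded around [m]; the cross term sums to 0 over [b]. *)
transitivity (\sum_b (alpha a * (x a - m) ^+ 2 * alpha b +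
    (alpha a * (alpha b * (x b - m) ^+ 2) -
     2 * alpha a * (x a - m) * (alpha b * (x b - m))))).
  by apply: eq_bigr => b _; ring.
by rewrite big_split/= sumrB -!mulr_sumr alpha1 sum0 mulr0 subr0 mulr1.
Qed.

Lemma quadratic_objectiveE alpha : simplex alpha ->
  quadratic_objective prior kappa alpha =
  \sum_theta prior theta * (average_utility alpha theta + (2 * kappa)^-1 *
    \sum_a alpha a * (utility a theta - average_utility alpha theta) ^+ 2).
Proof.
move=> alpha_simplex; under [RHS]eq_bigr do rewrite mulrDr.
rewrite big_split/=; congr (_ + _).
  under eq_bigr do rewrite /mean_utility mulr_sumr.
  rewrite exchange_big/=; apply: eq_bigr => theta _.
  by rewrite /average_utility mulr_sumr; apply: eq_bigr => a _; rewrite mulrCA.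
transitivity ((4 * kappa)^-1 * \sum_theta prior theta * (2 *
    \sum_a alpha a * (utility a theta - average_utility alpha theta) ^+ 2)).
  congr (_ * _); under [RHS]eq_bigr do rewrite -sum_sq_diff// mulr_sumr.
  rewrite [RHS]exchange_big/=; apply: eq_bigr => a _.
  under [RHS]eq_bigr do rewrite mulr_sumr.
  rewrite [RHS]exchange_big/=; apply: eq_bigr => b _.
  by rewrite /sq_dist mulr_sumr; apply: eq_bigr => theta _; rewrite mulrCA.
rewrite mulr_sumr; apply: eq_bigr => theta _.
have -> : (4 * kappa)^-1 = (2 * kappa)^-1 / 2.
  by rewrite -[4%N]/(2 * 2)%N natrM -mulrA invfM mulrC.
by rewrite mulrCA -[_ / 2 * _]mulrA mulKf// pnatr_eq0.
Qed.

(** The likelihood ratio makes [average_utility alpha theta] the coefficient of every [P theta a],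
    so only the total mass of [P theta] enters. *)
Lemma expected_utility_sub_tangent P alpha :
    0 < kappa -> choice_rules P -> simplex alpha ->
  expected_utility prior P -
    tangent_cost kappa prior (likelihood_ratio alpha) P alpha =
  quadratic_objective prior kappa alpha.
Proof.
move=> kappa_gt0 P_rule alpha_simplex; rewrite quadratic_objectiveE//.
rewrite -sumrB; apply: eq_bigr => theta _; rewrite -mulrBr; congr (_ * _).
set m := average_utility alpha theta; rewrite -sumrB.
transitivity (\sum_a (m * P theta a +
    (alpha a * (utility a theta - m) +
     (2 * kappa)^-1 * (alpha a * (utility a theta - m) ^+ 2)))).
  apply: eq_bigr => a _; rewrite /likelihood_ratio -/m; field.
  by rewrite gt_eqF.
have [_ P1] := P_rule theta.
by rewrite !big_split/= -!mulr_sumr P1 mulr1 sum_utility_gap// add0r.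
Qed.

(** * Payoffs compared with the quadratic objective *)

Section Payoff.
Hypotheses (kappa_gt0 : 0 < kappa) (prior_gt0 : forall theta, 0 < prior theta).

(** The tilted rule lies on the rays where tangent and cost agree, and information is at most the
    cost at [alpha]. *)
Lemma quadratic_objective_le_payoff alpha :
    choice_rules (tilted_rule alpha) -> simplex alpha ->
  ((quadratic_objective prior kappa alpha)%:E
     <= payoff prior kappa (tilted_rule alpha))%E.
Proof.
move=> Q_rule alpha_simplex.
rewrite -(expected_utility_sub_tangent _ _ kappa_gt0 Q_rule)// EFinB leeD2l//.
rewrite leeN2 -divergence_cost_ray// => [|theta a]; last by rewrite ffunE.
by apply: ereal_inf_lbound; exists alpha.
Qed.

(** Take [alpha] minimizing the divergence cost of [P]. The tangent bound at its likelihood ratio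
    gives the inequality, and its equality case the formula for [P]. *)
Lemma payoff_attained P : simplex prior -> choice_rules P ->
  exists alpha, [/\ simplex alpha,
    (payoff prior kappa P <= (quadratic_objective prior kappa alpha)%:E)%E &
    ((quadratic_objective prior kappa alpha)%:E <= payoff prior kappa P)%E ->
      forall theta a, P theta a = likelihood_ratio alpha theta a * alpha a].
Proof.
move=> prior_simplex P_rule.
have [alpha alpha_simplex [costE _]] :=
  chi2_information_attained kappa_gt0 prior_simplex prior_gt0 P_rule.
have P_ge0 theta a : 0 <= P theta a by case: (P_rule theta).
have alpha_ge0 a : 0 <= alpha a by case: alpha_simplex.
exists alpha; rewrite /payoff costE.
rewrite -(expected_utility_sub_tangent _ _ kappa_gt0 P_rule alpha_simplex).
split=> //; first by rewrite EFinB leeD2l// leeN2 tangent_cost_le.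
rewrite EFinB leeD2lE// leeN2 => le_cost.
exact: divergence_cost_le_tangent le_cost.
Qed.

End Payoff.

End DecisionProblem.

Theorem proposition4 (R : realType) (Theta : finType)
    (prior : {ffun Theta -> R}) (A : {fset {ffun Theta -> R}}) (kappa : R)
    (prior_simplex : simplex prior)
    (prior_full : forall theta, 0 < prior theta)
    (A_neq0 : A != fset0)
    (kappa_gt0 : 0 < kappa)
    (kappa_gt : (max_utility A - min_utility A < kappa%:E)%E)
    (P : Theta -> {ffun A -> R}) (P_rule : choice_rules P) :
  optimal prior kappa P <->
  exists alpha : {ffun A -> R},
    maximizer (@simplex R A) (quadratic_objective prior kappa) alpha /\
    forall (a : A) (theta : Theta),
      P theta a =
        alpha a + alpha a *
          ((utility a theta - \sum_(b : A) alpha b * utility b theta) / kappa).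
Proof.
have tilted_payoff (beta : {ffun A -> R}) : simplex beta ->
    choice_rules (tilted_rule A kappa beta) /\
    ((quadratic_objective prior kappa beta)%:E
       <= payoff prior kappa (tilted_rule A kappa beta))%E.
  move=> beta_simplex.
  have Q_rule := tilted_rule_choice A _ _ kappa_gt0 kappa_gt beta_simplex.
  by split=> //; exact: quadratic_objective_le_payoff.
split=> [[_ P_max]|[alpha [[alpha_simplex alpha_max] PE]]].
  have [alpha [alpha_simplex payoff_le PE]] :=
    payoff_attained prior A kappa kappa_gt0 prior_full P prior_simplex P_rule.
  (* Optimality of [P] is tested against tilted rules only. The case [beta = alpha] closes the
     tangent bound; the other cases make [alpha] a maximizer. *)
  have le_payoff (beta : {ffun A -> R}) : simplex beta ->
      ((quadratic_objective prior kappa beta)%:E <= payoff prior kappa P)%E.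
    by move=> /tilted_payoff[Q_rule /le_trans]; apply; exact: P_max.
  exists alpha; split=> [|a theta]; last first.
    by rewrite PE ?le_payoff// /likelihood_ratio mulrC mulrDr mulr1.
  by split=> // beta /le_payoff le_beta; rewrite -lee_fin (le_trans le_beta).
have {PE} -> : P = tilted_rule A kappa alpha.
  apply/funext => theta; apply/ffunP => a.
  by rewrite PE ffunE /likelihood_ratio [RHS]mulrC mulrDr mulr1.
have [Q_rule le_payoff] := tilted_payoff alpha alpha_simplex.
split=> // P' P'_rule.
(* The payoff of [P'] is at most the objective at [beta], hence at [alpha], hence the payoff of the
   tilted rule. *)
have [beta [beta_simplex payoff_le _]] :=
  payoff_attained prior A kappa kappa_gt0 prior_full P' prior_simplex P'_rule.
rewrite (le_trans payoff_le)// (le_trans _ le_payoff)// lee_fin.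
exact: alpha_max.
Qed.
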